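(* Let $(\mathcal{A},m)$ be a nonempty multiarrangement in an $\ell$-dimensional vector space $V$ over a field $\mathbb{K}$ with $\ell\ge 2$, let $H_0\in\mathcal{A}$, and let $(\mathcal{A},m),(\mathcal{A}',m'),(\mathcal{A}'',m^* )$ be the triple with respect to $H_0$. Assume that $(\mathcal{A},m)$ and $(\mathcal{A}'',m^* )$ are both free and $\exp(\mathcal{A}'',m^* )\subset\exp(\mathcal{A},m)$ (inclusion of multisets). Then $(\mathcal{A}',m')$ is also free.
   Context: Let $\mathbb{K}$ be a field, $V$ an $\ell$-dimensional $\mathbb{K}$-vector space, $S=\mathrm{Sym}(V^* )\cong\mathbb{K}[x_1,\ldots,x_\ell]$, and $\mathrm{Der}_{\mathbb{K}}(S)=\bigoplus_i S\,\partial_{x_i}$ the $S$-module of $\mathbb{K}$-linear derivations of $S$. An arrangement is a finite set $\mathcal{A}$ of hyperplanes of $V$, all containing the origin; for each $H\in\mathcal{A}$ fix a linear form $\alpha_H$ with $H=\ker\alpha_H$. A multiarrangement $(\mathcal{A},m)$ is an arrangement with a multiplicity $m:\mathcal{A}\to\mathbb{Z}_{>0}$. Define $D(\mathcal{A},m)=\{\theta\in\mathrm{Der}_{\mathbb{K}}(S)\mid\theta(\alpha_H)\in\alpha_H^{m(H)}S\text{ for all }H\in\mathcal{A}\}$; $(\mathcal{A},m)$ is free if $D(\mathcal{A},m)$ is a free $S$-module. A nonzero derivation $\theta=\sum f_i\partial_{x_i}$ is homogeneous of degree $p$ if each $f_i$ is zero or homogeneous of degree $p$. If $(\mathcal{A},m)$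 is free, $\exp(\mathcal{A},m)$ is the multiset of degrees of a homogeneous basis of $D(\mathcal{A},m)$ (independent of the basis). Triple with respect to $H_0\in\mathcal{A}$, with $\alpha_0=\alpha_{H_0}$: Deletion $(\mathcal{A}',m')$: if $m(H_0)=1$, then $\mathcal{A}'=\mathcal{A}\setminus\{H_0\}$ and $m'=m|_{\mathcal{A}'}$; if $m(H_0)\ge2$, then $\mathcal{A}'=\mathcal{A}$, $m'(H)=m(H)$ for $H\ne H_0$, and $m'(H_0)=m(H_0)-1$. Restriction $(\mathcal{A}'',m^* )$: $\mathcal{A}''=\{H_0\cap K\mid K\in\mathcal{A}\setminus\{H_0\}\}$, an arrangement in the vector space $H_0$, and $m^*$ is the Euler multiplicity: for $X\in\mathcal{A}''$ put $\mathcal{A}_X=\{H\in\mathcal{A}\mid X\subset H\}$, $m_X=m|_{\mathcal{A}_X}$, and choose coordinates so that $X=\{x_1=x_2=0\}$; then $D(\mathcal{A}_X,m_X)$ has a homogeneous basis $\theta_X,\psi_X,\partial_{x_3},\ldots,\partial_{x_\ell}$ with $\theta_X\notin\alpha_0\mathrm{Der}_{\mathbb{K}}(S)$ and $\psi_X\in\alpha_0\mathrm{Der}_{\mathbb{K}}(S)$, and $m^*(X):=\deg\theta_X$. *)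

(* Defs.v *)
From HB Require Import structures.
From mathcomp Require Import all_boot all_order all_algebra.
From mathcomp Require Import finmap multiset.
From mathcomp.multinomials Require Import mpoly.

Set Implicit Arguments.
Unset Strict Implicit.
Unset Printing Implicit Defensive.

Import GRing.Theory.
Local Open Scope ring_scope.
Local Open Scope fset_scope.

(* S = Sym(V^* ) is realised as K[x_0, ..., x_(l-1)], where x_i is the i-th
   coordinate function in the basis vbasis fullv of V; a derivation
   \sum_i f_i d/dx_i is the row vector of its coefficients f_i, so that Der_K(S)
   is the S-module S^l. *)
Definition Sym (K : fieldType) (V : vectType K) := {mpoly K[\dim {:V}]}.

Definition Der (K : fieldType) (V : vectType K) :=
  'rV[{mpoly K[\dim {:V}]}]_(\dim {:V}).

Section Derivations.
Variables (K : fieldType) (V : vectType K).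

Definition form_poly (a : 'Hom(V, K^o)) : Sym V :=
  \sum_(i < \dim {:V}) (a (vbasis {:V})`_i : K) *: 'X_i.

Definition der_app (theta : Der V) (f : Sym V) : Sym V :=
  \sum_(i < \dim {:V}) theta 0 i * f^`M(i).

(* The directional derivative along v. If (x_i) are the coordinates attached to
   a basis e of V, then d/dx_i is dir_der e`_i. *)
Definition dir_der (v : V) : Der V :=
  \row_(i < \dim {:V}) (coord (vbasis {:V}) i v)%:MP.

Definition homogeneous_der (p : nat) (theta : Der V) : Prop :=
  theta != 0 /\ forall i, theta 0 i \is p.-homog.

Definition is_basis (M : Der V -> Prop) (r : nat) (B : 'I_r -> Der V) : Prop :=
  (forall theta, M theta <->
     exists c : 'I_r -> Sym V, theta = \sum_(i < r) c i *: B i) /\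
  (forall c : 'I_r -> Sym V,
     \sum_(i < r) c i *: B i = 0 -> forall i, c i = 0).

(* S is Noetherian, so submodules of Der_K(S) are finitely generated, and a
   finite basis is all that freeness can mean. *)
Definition is_free (M : Der V -> Prop) : Prop :=
  exists (r : nat) (B : 'I_r -> Der V), is_basis M B.

Definition is_exp (M : Der V -> Prop) (E : {mset nat}%mset) : Prop :=
  exists (r : nat) (B : 'I_r -> Der V) (d : 'I_r -> nat),
    [/\ is_basis M B,
        forall i, homogeneous_der (d i) (B i)
      & E = seq_mset (codom d)].

End Derivations.

Section Arrangements.
Variables (K : fieldType) (V : vectType K).
Implicit Types (A : {fset {vspace V}}) (m : {vspace V} -> nat).
Implicit Types (alpha : {vspace V} -> 'Hom(V, K^o)).

(* Only the values of m on A matter. *)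
Definition is_multiarrangement A m : Prop :=
  forall H, H \in A -> (\dim H).+1 = \dim {:V} /\ (0 < m H)%N.

Definition defining_forms A alpha : Prop :=
  forall H, H \in A -> lker (alpha H) = H.

Definition logder A m alpha (theta : Der V) : Prop :=
  forall H, H \in A -> exists q : Sym V,
    der_app theta (form_poly (alpha H)) = form_poly (alpha H) ^+ m H * q.

Definition deletion A m (H0 : {vspace V}) : {fset {vspace V}} :=
  if m H0 == 1%N then A `\ H0 else A.

Definition deletion_mult m (H0 : {vspace V}) : {vspace V} -> nat :=
  fun H => if (H == H0) && (2 <= m H0)%N then (m H0).-1 else m H.

(* The preimage of K' under the inclusion of H0 is H0 :&: K', seen as a subspace
   of the vector space H0. *)
Definition restriction A (H0 : {vspace V}) : {fset {vspace subvs_of H0}} :=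
  [fset (linfun (@vsval _ _ H0) @^-1: K')%VS | K' in A `\ H0].

Definition localization A (X : {vspace V}) : {fset {vspace V}} :=
  [fset H in A | (X <= H)%VS].

Definition in_alpha_Der (a : 'Hom(V, K^o)) (theta : Der V) : Prop :=
  exists eta : Der V, theta = form_poly a *: eta.

(* d is the Euler multiplicity of X: the degree of theta_X, for a choice of
   coordinates coord e 0, coord e 1, ... of V in which X is the common zero set
   of the first two, and of a homogeneous basis
   theta_X, psi_X, d/dx_2, d/dx_3, ... of D(A_X, m_X). *)
Definition is_euler_mult A m alpha (H0 : {vspace V})
    (X : {vspace subvs_of H0}) (d : nat) : Prop :=
  let XV := (linfun (@vsval _ _ H0) @: X)%VS in
  exists (e : (\dim {:V}).-tuple V) (theta psi : Der V) (p : nat),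
    [/\ basis_of {:V} e /\
        (forall v : V, v \in XV <->
           forall i : 'I_(\dim {:V}), (i < 2)%N -> coord e i v = 0),
        is_basis (logder (localization A XV) m alpha)
          (fun i : 'I_(\dim {:V}) =>
             if val i == 0%N then theta
             else if val i == 1%N then psi else dir_der e`_i),
        homogeneous_der d theta /\ homogeneous_der p psi,
        ~ in_alpha_Der (alpha H0) theta
      & in_alpha_Der (alpha H0) psi].

End Arrangements.

(* Main.v *)
(* Restriction to H0 maps D(A, m) into D(A'', m-star), and its kernel is
   alpha_0 D(A', m'). Let theta_1, ..., theta_l be a homogeneous basis of D(A, m).
   Since exp(A'', m-star) is strictly contained in exp(A, m), counting degrees shows
   that the restriction of some theta_k is a combination of the others, so that
   theta_k may be changed into an element alpha_0 eta of the kernel. The restrictions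
   of the remaining l - 1 elements generate a submodule of full rank, so they are
   independent, and this forces eta and the theta_i with i != k to be a basis of
   D(A', m'). *)
From HB Require Import structures.
Require Import Defs.
From mathcomp Require Import all_boot all_order all_algebra.
From mathcomp Require Import finmap multiset.
From mathcomp.multinomials Require Import mpoly.
From mathcomp Require Import ring.

Set Implicit Arguments.
Unset Strict Implicit.
Unset Printing Implicit Defensive.

Import GRing.Theory.

(** * Linear algebra over a domain *)

(** The restriction map is not known to be onto, so the images of the theta_i need not generate
    D(A'', m-star). What is available is that each image is a combination of a basis of D(A'',
    m-star), and the comparison has to go degree by degree to yield a relation in which one
    coefficient is exactly 1. The other coefficients may be inhomogeneous: only freeness is claimed,
    so eta need not be homogeneous. No coordinates with alpha_0 = x_1 are chosen. The inclusion of
    H0 in V and a linear retraction of V onto H0 replace them, and the retraction lifts relations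
    from H0 to V. Full rank is certified by an identity [W *m T = Q%:M] with Q nonzero. It comes
    from the derivations Q d/dv in D(A, m), where v lies in H0 and Q is the product of the
    alpha_H^m(H) over H != H0; this Q does not vanish identically on H0. *)

Section DomainLinearAlgebra.
Local Open Scope ring_scope.
Variable R : idomainType.
Local Notation tofrac := (@FracField.tofrac R).

Lemma fraction_quotient (x : {fraction R}) :
  exists2 d : R, d != 0 & exists c : R, tofrac d * x = tofrac c.
Proof.
exists (\d_(repr x)); first exact: denom_ratioP.
exists (\n_(repr x)); rewrite -{2}[x]reprK; unlock FracField.tofrac.
rewrite -[LHS]FracField.pi_mul; apply/eqmodP => /=.
rewrite FracField.equivfE /FracField.mulf !numden_Ratio ?mul1r ?mulr1 ?oner_eq0 //.
all: exact: denom_ratioP.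
Qed.

Lemma fraction_common_denominator n (v : 'rV[{fraction R}]_n) :
  exists2 d : R, d != 0 &
    exists c : 'rV[R]_n, tofrac d *: v = map_mx tofrac c.
Proof.
have /fin_all_exists2[d d0 /fin_all_exists[c dc]] :=
  fun i => fraction_quotient (v 0 i).
exists (\prod_i d i); first by apply/prodf_neq0.
exists (\row_i ((\prod_(j | j != i) d j) * c i)); apply/rowP => i.
by rewrite !mxE (bigD1 i) //= !rmorphM /= mulrAC dc mulrC.
Qed.

Lemma map_tofrac_inj p q :
  injective (map_mx tofrac : 'M[R]_(p, q) -> 'M_(p, q)).
Proof.
move=> A B eqAB; apply/matrixP => i j.
by move/matrixP/(_ i j): eqAB => /[!mxE] /eqP; rewrite tofrac_eq => /eqP.
Qed.

Lemma domain_rows_dependent p q (T : 'M[R]_(p, q)) :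
  (q < p)%N -> exists2 c : 'rV[R]_p, c != 0 & c *m T = 0.
Proof.
move=> ltqp; have : kermx (map_mx tofrac T) != 0.
  rewrite kermx_eq0 /row_free neq_ltn.
  by rewrite (leq_ltn_trans (rank_leq_col _)).
case/rowV0Pn => v /sub_kermxP vT v0.
have [d d0 [c dc]] := fraction_common_denominator v.
exists c.
  apply: contraNneq v0 => c0; move: dc; rewrite c0 map_mx0 => /eqP.
  by rewrite scaler_eq0 tofrac_eq0 (negPf d0).
apply: map_tofrac_inj.
by rewrite map_mxM -dc -scalemxAl vT scaler0 map_mx0.
Qed.

(** Over the fraction field [a] becomes invertible, so [T] has a left inverse. The hypothesis says
    that the row span of [T] contains [a] times the standard basis. *)
Lemma mxrank_tofrac_ge p q (W : 'M[R]_(q, p)) (T : 'M[R]_(p, q)) a :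
  a != 0 -> W *m T = a%:M -> (q <= \rank (map_mx tofrac T))%N.
Proof.
move=> a0 WT; apply: leq_trans (mxrankM_maxr (map_mx tofrac W) _).
rewrite -map_mxM WT map_scalar_mx -scalemx1 mxrank_scale_nz ?mxrank1 //.
by rewrite tofrac_eq0.
Qed.

Lemma domain_rows_free p q (W : 'M[R]_(q, p)) (T : 'M[R]_(p, q)) a :
  a != 0 -> W *m T = a%:M -> (p <= q)%N ->
  forall c : 'rV[R]_p, c *m T = 0 -> c = 0.
Proof.
move=> a0 WT lepq c cT; apply: map_tofrac_inj.
apply: (@row_free_inj _ _ _ _ (map_mx tofrac T)).
  by rewrite /row_free eqn_leq rank_leq_row (leq_trans lepq (mxrank_tofrac_ge a0 WT)).
by rewrite -map_mxM cT !map_mx0 mul0mx.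
Qed.

Lemma domain_scalar_factor p q (W : 'M[R]_(q, p)) (T : 'M[R]_(p, q)) a :
  a != 0 -> W *m T = a%:M -> (q <= p)%N.
Proof.
by move=> a0 /(mxrank_tofrac_ge a0)/leq_trans; apply; apply: rank_leq_row.
Qed.

End DomainLinearAlgebra.

(** * Redundancy among graded generators *)

Section GradedGenerators.
Local Open Scope ring_scope.
Variable K : fieldType.

(** Either the rows of the submatrix of [C] on [I] and [J] are dependent, which gives [x], or the
    bound on the cardinals makes it square and invertible, and the rows of its inverse give the
    [y]. *)
Lemma minor_dichotomy r s (I : {set 'I_r}) (J : {set 'I_s}) (C : 'M[K]_(r, s)) :
  (#|J| <= #|I|)%N ->
  (exists x : 'rV[K]_r, [/\ x != 0, forall i, i \notin I -> x 0 i = 0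
      & forall j, j \in J -> (x *m C) 0 j = 0]) \/
  (#|I| = #|J| /\ forall j, j \in J -> exists2 y : 'rV[K]_r,
      forall i, i \notin I -> y 0 i = 0
      & forall j', j' \in J -> (y *m C) 0 j' = (j == j')%:R).
Proof.
move=> leJI.
(* [P] extends a row indexed by [I] by zero and [Q] extracts the columns in [J], so [P *m C *m Q] is
   the submatrix. *)
pose P := \matrix_(a < #|I|, i < r) ((enum_val a == i)%:R : K).
pose Q := \matrix_(j < s, b < #|J|) ((enum_val b == j)%:R : K).
have vP0 (v : 'rV_#|I|) i : i \notin I -> (v *m P) 0 i = 0.
  move=> iI; rewrite mxE big1 // => a _; rewrite mxE.
  by case: eqP => [ai|]; rewrite ?mulr0 //; rewrite -ai enum_valP in iI.
have vP (v : 'rV_#|I|) a : (v *m P) 0 (enum_val a) = v 0 a.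
  rewrite mxE (bigD1 a) //= mxE eqxx mulr1 big1 ?addr0 // => b ba.
  by rewrite mxE (inj_eq enum_val_inj) (negPf ba) mulr0.
have wQ (w : 'rV_s) b : (w *m Q) 0 b = w 0 (enum_val b).
  rewrite mxE (bigD1 (enum_val b)) //= mxE eqxx mulr1 big1 ?addr0 // => j jb.
  by rewrite mxE eq_sym (negPf jb) mulr0.
case: (boolP (row_free (P *m C *m Q))) => [free|nfree]; [right | left].
  have eqIJ : #|I| = #|J|.
    by apply/eqP; rewrite eqn_leq leJI -(eqP free) rank_leq_col.
  split=> // j jJ; pose b := enum_rank_in jJ j.
  have /row_fullP[B BPCQ] : row_full (P *m C *m Q).
    by rewrite /row_full (eqP free) eqIJ.
  exists (row b B *m P) => [i /vP0-> //|j' j'J].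
  rewrite -[j'](enum_rankK_in jJ) // -wQ -!mulmxA -row_mul (mulmxA P) BPCQ.
  by rewrite !mxE -(inj_eq enum_val_inj) (enum_rankK_in jJ jJ).
move: nfree; rewrite -kermx_eq0 => /rowV0Pn[v /sub_kermxP vPCQ v0].
exists (v *m P); split=> [||j jJ]; last 1 first.
- rewrite -[j](enum_rankK_in jJ) // -wQ -!mulmxA (mulmxA P) vPCQ mxE //.
- apply: contraNneq v0 => vP_0; apply/eqP/rowP => a.
  by rewrite -vP vP_0 !mxE.
- exact: vP0.
Qed.

(** This makes the coefficients in a combination of homogeneous vectors homogeneous. The case split
    is needed because [d - e] truncates at 0. *)
Lemma pihomogM n (p q : {mpoly K[n]}) d e : q \is e.-homog ->
  pihomog mdeg d (p * q) =
    if (e <= d)%N then pihomog mdeg (d - e) p * q else 0.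
Proof.
move=> qe; rewrite {1}(pihomog_partitionE (leqnn (msize p))).
have homM b : pihomog mdeg b p * q \is (b + e).-homog.
  by apply: dhomogM => //; exact: pihomogP.
rewrite mulr_suml raddf_sum /=.
have term b : pihomog mdeg d (pihomog mdeg b p * q) =
    if (b + e == d)%N then pihomog mdeg b p * q else 0.
  case: ifP => [/eqP bd|/negbT bd]; first by rewrite pihomog_dE // -bd.
  by rewrite (pihomog_ne0 bd).
under eq_bigr => b _ do rewrite term.
rewrite -big_mkcond /=.
case: leqP => [led|ltd]; last first.
  by rewrite big1 // => b /eqP bd; rewrite -bd ltnNge leq_addl in ltd.
rewrite [in RHS](pihomog_partitionE (leqnn (msize p))).
rewrite raddf_sum mulr_suml /= big_mkcond /=.
apply: eq_bigr => b _.
have -> : (b + e == d)%N = (b == d - e :> nat)%N by rewrite -(eqn_add2r e b) subnK.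
case: eqVneq => [<-|bd]; first by rewrite pihomog_id.
by rewrite (@pihomog_ne0 _ _ _ b) ?mul0r ?pihomogP // eq_sym.
Qed.

Lemma dhomog0_const n (p : {mpoly K[n]}) : p \is 0.-homog -> p = (p@_0)%:MP.
Proof.
move=> p0; apply/mpolyP => m; rewrite mcoeffC.
case: eqVneq => [->|m0]; first by rewrite mulr1.
by rewrite mulr0 (dhomog_nemf_coeff p0) // mdeg_eq0.
Qed.

Lemma exists_larger_fibre r s (d : 'I_r -> nat) (e : 'I_s -> nat) :
  (s < r)%N -> exists t, (#|[set j | e j == t]| < #|[set i | d i == t]|)%N.
Proof.
(* All values of [d] lie below [N], so its fibres below [N] count all of [r]; those of [e] count at
   most [s]. *)
move=> ltsr; pose N := (\max_(i < r) d i).+1.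
have fibreE k (f : 'I_k -> nat) :
    (\sum_(t < N) #|[set i | f i == t]| = \sum_i (f i < N))%N.
  transitivity (\sum_(t < N) \sum_(i in [set i | f i == t]) 1)%N.
    by apply: eq_bigr => t _; rewrite sum1_card.
  rewrite (exchange_big_dep predT) //=; apply: eq_bigr => i _.
  under eq_bigl => t do rewrite inE.
  have [fiN|fiN] := ltnP (f i) N.
    by rewrite (big_pred1 (Ordinal fiN)) // => t; rewrite eq_sym.
  by rewrite big_pred0 // => t; rewrite gtn_eqF // (leq_trans _ fiN).
have [/existsP[t ltt]|] :=
    boolP [exists t : 'I_N, #|[set j | e j == t]| < #|[set i | d i == t]|]%N.
  by exists (val t).
rewrite negb_exists => /forallP leIJ; rewrite ltnNge in ltsr; case/negP: ltsr.
have -> : r = (\sum_i (d i < N))%N.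
  rewrite -{1}[r]card_ord -sum1_card; apply: eq_bigr => i _.
  by rewrite ltnS (leq_bigmax i).
rewrite -fibreE -[s]card_ord -sum1_card.
apply: (@leq_trans (\sum_j (e j < N))%N); last first.
  by apply: leq_sum => j _; case: (_ < _)%N.
by rewrite -fibreE leq_sum // => t _; rewrite leqNgt.
Qed.

(* Work degree by degree. If no u_i were redundant, then in each degree t, modulo
   what lower degrees generate, the u_i of degree t would be independent
   combinations of the at most as many phi_j of degree t, hence would generate
   these; but some degree has strictly fewer phi_j. *)
Lemma graded_redundancy n k r s
    (u : 'I_r -> 'rV[{mpoly K[n]}]_k) (phi : 'I_s -> 'rV[{mpoly K[n]}]_k) d e :
  (forall i l, u i 0 l \is (d i).-homog) ->
  (forall j l, phi j 0 l \is (e j).-homog) ->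
  (forall i, exists c : 'I_s -> {mpoly K[n]}, u i = \sum_j c j *: phi j) ->
  (forall t, #|[set j | e j == t]| <= #|[set i | d i == t]|)%N ->
  (s < r)%N ->
  exists i0 (c : 'I_r -> {mpoly K[n]}), c i0 = 1 /\ \sum_i c i *: u i = 0.
Proof.
move=> hu hphi hspan leJI ltsr; set concl := ex _.
(* As [u i] is homogeneous, only the component of degree [d i - e j] of each coefficient
   contributes. *)
have hspan' i : exists c : 'I_s -> {mpoly K[n]},
    [/\ u i = \sum_j c j *: phi j, forall j, (d i < e j)%N -> c j = 0
      & forall j, c j \is (d i - e j).-homog].
  have [c uE] := hspan i.
  exists (fun j => if (e j <= d i)%N then pihomog mdeg (d i - e j) (c j) else 0).
  split=> [|j|j].
  - apply/rowP => l; rewrite -[LHS](pihomog_dE (hu i l)) uE !summxE raddf_sum.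
    apply: eq_bigr => j _; rewrite /= !mxE (pihomogM _ _ (hphi j l)).
    by case: ifP; rewrite ?mul0r.
  - by rewrite ltnNge => /negPf->.
  - by case: ifP => _; [exact: pihomogP | exact: rpred0].
have [c /all_and3[uE c0 chom]] := fin_all_exists hspan'.
(* An entry is [c i j] itself when [e j = d i], and 0 otherwise. *)
pose C := \matrix_(i, j) (c i j)@_0.
(* [low t] is the submodule generated by the [u i] of degree less than [t]. *)
pose low t w := exists2 a : 'I_r -> {mpoly K[n]},
  forall i, (t <= d i)%N -> a i = 0 & w = \sum_i a i *: u i.
have low0 t : low t 0.
  by exists (fun=> 0) => //; rewrite big1 // => i _; rewrite scale0r.
have lowD t w1 w2 : low t w1 -> low t w2 -> low t (w1 + w2).
  move=> [a1 a10 ->] [a2 a20 ->]; exists (fun i => a1 i + a2 i).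
    by move=> i ti; rewrite a10 // a20 // addr0.
  by rewrite -big_split; apply: eq_bigr => i _; rewrite scalerDl.
have lowZ t b w : low t w -> low t (b *: w).
  move=> [a a0 ->]; exists (fun i => b * a i).
    by move=> i ti; rewrite a0 // mulr0.
  by rewrite scaler_sumr; apply: eq_bigr => i _; rewrite scalerA.
have lowW t t' w : (t <= t')%N -> low t w -> low t' w.
  by move=> tt' [a a0 ->]; exists a => // i t'i; apply/a0/(leq_trans tt').
have uxE t (x : 'rV[K]_r) : (forall i, i \notin [set i | d i == t] -> x 0 i = 0) ->
    (forall j, (e j < t)%N -> low t (phi j)) ->
    exists2 w, low t w & \sum_i (x 0 i)%:MP *: u i =
      \sum_(j | e j == t) ((x *m C) 0 j)%:MP *: phi j + w.
  move=> x0 lowphi.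
  exists (\sum_(j | (e j < t)%N) (\sum_i (x 0 i)%:MP * c i j) *: phi j).
    by elim/big_ind: _ => // [|j ejt]; [exact: lowD | exact/lowZ/lowphi].
  transitivity (\sum_j (\sum_i (x 0 i)%:MP * c i j) *: phi j).
    under eq_bigr => i _ do rewrite uE scaler_sumr.
    rewrite exchange_big; apply: eq_bigr => j _.
    by rewrite scaler_suml; apply: eq_bigr => i _; rewrite scalerA.
  rewrite (bigID (fun j => e j == t)) /=; congr (_ + _).
    apply: eq_bigr => j /eqP ejt; congr (_ *: _).
    rewrite mxE raddf_sum; apply: eq_bigr => i _; rewrite mxE /= mpolyCM.
    have [dit|dit] := eqVneq (d i) t; last by rewrite x0 ?inE // mpolyC0 !mul0r.
    by have := chom i j; rewrite dit ejt subnn => /dhomog0_const <-.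
  rewrite (bigID (fun j => (e j < t)%N)) /= addrC big1 ?add0r; last first.
    move=> j /andP[ejt]; rewrite -leqNgt leq_eqVlt eq_sym (negPf ejt) /= => tej.
    rewrite big1 ?scale0r // => i _.
    have [dit|dit] := eqVneq (d i) t; last by rewrite x0 ?inE // mpolyC0 mul0r.
    by rewrite c0 ?mulr0 // dit.
  by apply: eq_bigl => j; rewrite andbC; case: ltngtP.
have step t : (forall j, (e j < t)%N -> low t (phi j)) ->
    concl \/ #|[set i | d i == t]| = #|[set j | e j == t]| /\
      (forall j, (e j < t.+1)%N -> low t.+1 (phi j)).
  move=> lowphi; case: (minor_dichotomy C (leJI t)).
    case=> x [xn0 x0 xC]; left.
    have [w [a a0 wE] uE'] := uxE t x x0 lowphi.
    case/rV0Pn: xn0 => i0 xi0.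
    have di0 : d i0 = t.
      by apply/eqP; apply: contraNT xi0 => di0; rewrite x0 // inE.
    (* The lower part [a] vanishes at [i0], whose degree is [t], so the coefficient there is the
       constant [x 0 i0] and can be scaled to 1. *)
    exists i0, (fun i => ((x 0 i0)^-1)%:MP * ((x 0 i)%:MP - a i)); split.
      by rewrite a0 ?di0 // subr0 -mpolyCM mulVf.
    under eq_bigr => i _ do rewrite -scalerA scalerBl.
    rewrite -scaler_sumr sumrB uE' -wE big1 ?add0r ?subrr ?scaler0 //.
    by move=> j ejt; rewrite xC ?inE // mpolyC0 scale0r.
  case=> eqIJ hy; right; split=> // j.
  rewrite ltnS leq_eqVlt => /predU1P[ejt|]; last first.
    by move=> /lowphi; apply: lowW.
  have [|y y0 yC] := hy j; first by rewrite inE ejt.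
  have [w loww] := uxE t y y0 lowphi.
  rewrite (bigD1 j) ?ejt //= yC ?inE ?ejt // eqxx mpolyC1 scale1r.
  rewrite [X in _ = _ + X + _]big1 ?addr0; last first.
    move=> j' /andP[ej' j'j]; rewrite yC ?inE // eq_sym (negPf j'j).
    by rewrite mpolyC0 scale0r.
  move=> /esym/(canRL (addrK _)) ->; apply: lowD; last first.
    by rewrite -scaleN1r; apply/lowZ/(lowW _ _ _ (leqnSn t)).
  exists (fun i => (y 0 i)%:MP) => // i lti.
  by rewrite y0 ?mpolyC0 // inE gtn_eqF.
have all_t t : concl \/ forall j, (e j < t)%N -> low t (phi j).
  elim: t => [|t [|/step[|[_]]]]; by [right | left].
have [t] := exists_larger_fibre d e ltsr.
have [//|/step[//|[-> _]]] := all_t t.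
by rewrite ltnn.
Qed.

End GradedGenerators.

(** * Linear forms and linear substitutions *)

Section PolynomialSubstitution.
Local Open Scope ring_scope.
Variable K : fieldType.

Lemma mpoly_rmorph_eq n (R : comNzRingType) (f g : {rmorphism {mpoly K[n]} -> R}) :
  (forall c, f c%:MP = g c%:MP) -> (forall i, f 'X_i = g 'X_i) -> f =1 g.
Proof.
move=> fgC fgX p; elim/mpolyind: p => [|c m p _ _ IH]; first by rewrite !rmorph0.
rewrite -mul_mpolyC !rmorphD !rmorphM /= IH fgC mpolyXE_id !rmorph_prod /=.
by congr (_ * _ + _); apply: eq_bigr => i _; rewrite !rmorphXn /= fgX.
Qed.

Lemma comp_mpolyA n k l (lq : n.-tuple {mpoly K[k]}) (lp : k.-tuple {mpoly K[l]}) p :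
  (p \mPo lq) \mPo lp = p \mPo [tuple tnth lq i \mPo lp | i < n].
Proof.
pose f : {rmorphism _ -> _} := comp_mpoly lp \o comp_mpoly lq.
apply: (mpoly_rmorph_eq (f := f)) => [c|i] /=; first by rewrite !comp_mpolyC.
by rewrite !comp_mpolyXU -!tnth_nth tnth_mktuple.
Qed.

(** Congruence modulo [a] respects sums and products. It serves to compare the identity of V with
    its retraction onto the hyperplane [a = 0]. *)
Lemma comp_mpoly_congr n k (a : {mpoly K[k]}) (lq lp : n.-tuple {mpoly K[k]}) p :
  (forall i, exists q, tnth lq i = tnth lp i + a * q) ->
  exists q, p \mPo lq = p \mPo lp + a * q.
Proof.
move=> lqp; pose C x y := exists q : {mpoly K[k]}, x = y + a * q.
have CD x1 y1 x2 y2 : C x1 y1 -> C x2 y2 -> C (x1 + x2) (y1 + y2).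
  by move=> [q1 ->] [q2 ->]; exists (q1 + q2); rewrite mulrDr addrACA.
have CM x1 y1 x2 y2 : C x1 y1 -> C x2 y2 -> C (x1 * x2) (y1 * y2).
  move=> [q1 ->] [q2 ->]; exists (y1 * q2 + y2 * q1 + a * q1 * q2).
  by ring.
have C1 x : C x x by exists 0; rewrite mulr0 addr0.
rewrite -/(C _ _); elim/mpolyind: p => [|c m p _ _ IH]; first by rewrite !comp_mpoly0.
rewrite !comp_mpolyD !comp_mpolyZ; apply: (CD _ _ _ _ _ IH).
rewrite -!mul_mpolyC; apply/CM => //; rewrite !comp_mpolyX.
apply: (big_ind2 C (C1 1) CM) => i _; elim: (m i) => [|j IHj]; first by rewrite !expr0.
by rewrite !exprS; apply/CM => //; apply: lqp.
Qed.

Lemma comp_mpoly_homog n k (lq : n.-tuple {mpoly K[k]}) d p :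
  (forall i, tnth lq i \is 1.-homog) -> p \is d.-homog -> p \mPo lq \is d.-homog.
Proof.
move=> lq1 pd; rewrite comp_mpolyEX big_seq rpred_sum // => m mp.
apply: rpredZ; rewrite comp_mpolyX -(dhomog_mf pd mp) /= mdegE.
elim/big_ind2: _ => [|e x f y xe yf|i _]; [exact: dhomog1 | exact: dhomogM |].
by have := dhomogMn (m i) (lq1 i); rewrite mul1n.
Qed.

End PolynomialSubstitution.

Section LinearForms.
Local Open Scope ring_scope.
Variables (K : fieldType).
Implicit Types (V W U : vectType K).
Local Notation S V := {mpoly K[\dim {:V}]}.

(* The codomain K^o of a linear form is only convertible to K: these restate the
   generic lemmas with values in the field K. *)
Lemma formDE V (a b : 'Hom(V, K^o)) v : (a + b) v = a v + b v :> K.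
Proof. exact (add_lfunE a b v). Qed.

Lemma formZE V k (a : 'Hom(V, K^o)) v : (k *: a) v = k * (a v : K) :> K.
Proof. exact (scale_lfunE k a v). Qed.

Lemma form0E V (v : V) : (0 : 'Hom(V, K^o)) v = 0 :> K.
Proof. by rewrite -(scale0r (0 : 'Hom(V, K^o))) formZE mul0r. Qed.

Lemma form_compE V W (u : 'Hom(W, V)) (a : 'Hom(V, K^o)) w :
  (a \o u)%VF w = a (u w) :> K.
Proof. exact (comp_lfunE a u w). Qed.

Lemma form_kerE V (a : 'Hom(V, K^o)) v : (v \in lker a) = ((a v : K) == 0).
Proof. exact (memv_ker a v). Qed.

Lemma form_linear V (a : 'Hom(V, K^o)) k v w :
  a (k *: v + w) = k * (a v : K) + a w :> K.
Proof. exact (linearP a k v w). Qed.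

Lemma eq_form V (a b : 'Hom(V, K^o)) : (forall v, a v = b v :> K) -> a = b.
Proof. by move=> ab; apply/lfunP. Qed.

Lemma form_sumE V I (s : seq I) (F : I -> 'Hom(V, K^o)) v :
  (\sum_(i <- s) F i) v = \sum_(i <- s) (F i v : K) :> K.
Proof. exact (sum_lfunE s xpredT F v). Qed.

Definition coord_form V (i : 'I_(\dim {:V})) : 'Hom(V, K^o) :=
  linfun (coord (vbasis {:V}) i : V -> K^o).

Lemma coord_formE V i (v : V) : coord_form i v = coord (vbasis {:V}) i v.
Proof. by rewrite lfunE. Qed.

Lemma linear_form_sum V (a : 'Hom(V, K^o)) v :
  a v = \sum_(i < \dim {:V}) a (vbasis {:V})`_i * coord_form i v.
Proof.
rewrite {1}(coord_vbasis (memvf v)) linear_sum /=.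
by apply: eq_bigr => i _; rewrite linearZ coord_formE mulrC.
Qed.

Lemma form_poly_is_linear V : linear (@form_poly K V).
Proof.
move=> k a b; rewrite /form_poly scaler_sumr -big_split; apply: eq_bigr => i _ /=.
by rewrite formDE formZE scalerDl scalerA.
Qed.

HB.instance Definition _ V := GRing.isLinear.Build K 'Hom(V, K^o) (S V) _
  (@form_poly K V) (@form_poly_is_linear V).

Lemma form_polyZ V k (a : 'Hom(V, K^o)) : form_poly (k *: a) = k *: form_poly a.
Proof.
by rewrite /form_poly scaler_sumr; apply: eq_bigr => i _; rewrite formZE scalerA.
Qed.

Lemma form_poly_homog V (a : 'Hom(V, K^o)) : form_poly a \is 1.-homog.
Proof. by apply: rpred_sum => i _; apply: rpredZ; rewrite dhomogX /= mdeg1. Qed.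

Lemma form_poly_coeff V (a : 'Hom(V, K^o)) i :
  (form_poly a)@_U_(i) = a (vbasis {:V})`_i.
Proof.
rewrite /form_poly raddf_sum (bigD1 i) //= mcoeffZ mcoeffXU eqxx mulr1.
by rewrite big1 ?addr0 // => j ji; rewrite mcoeffZ mcoeffXU (negPf ji) mulr0.
Qed.

Lemma form_poly_eq0 V (a : 'Hom(V, K^o)) : (form_poly a == 0) = (a == 0).
Proof.
apply/eqP/eqP => [a0|->]; last exact: linear0.
apply: eq_form => v; rewrite linear_form_sum form0E big1 // => i _.
by rewrite -form_poly_coeff a0 mcoeff0 mul0r.
Qed.

Lemma coord_form_basis V (i j : 'I_(\dim {:V})) :
  coord_form i (vbasis {:V})`_j = (i == j)%:R.
Proof.
by rewrite coord_formE coord_free 1?eq_sym //; exact: basis_free (vbasisP _).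
Qed.

Lemma form_poly_coord V (i : 'I_(\dim {:V})) : form_poly (coord_form i) = 'X_i.
Proof.
rewrite /form_poly (bigD1 i) //= coord_form_basis eqxx scale1r.
rewrite big1 ?addr0 // => j; rewrite eq_sym coord_form_basis => /negPf->.
by rewrite scale0r.
Qed.

Lemma lker_sub_scale V (a b : 'Hom(V, K^o)) :
  (lker a <= lker b)%VS -> exists k : K, b = k *: a.
Proof.
move=> /subvP ab; have [a0|a0] := eqVneq a 0.
  exists 0; rewrite scale0r; apply: eq_form => v; rewrite form0E.
  by apply/eqP; rewrite -form_kerE ab // form_kerE a0 form0E.
have [i ai] : exists i : 'I_(\dim {:V}), (a (vbasis {:V})`_i : K) != 0.
  apply/existsP; apply: contraNT a0; rewrite negb_exists => /forallP a0.
  apply/eqP/eq_form => v; rewrite linear_form_sum form0E big1 // => i _.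
  by have := a0 i; rewrite negbK => /eqP ->; rewrite mul0r.
set v := (vbasis {:V})`_i in ai; exists ((b v : K) / a v); apply: eq_form => w.
have : - ((a w : K) / a v) *: v + w \in lker b.
  by apply: ab; rewrite form_kerE form_linear mulNr divfK // addNr.
rewrite form_kerE form_linear addrC mulNr subr_eq0 => /eqP ->.
by rewrite formZE; field.
Qed.

(* Substituting pull_tuple u is composition with u on polynomial functions. *)
Definition pull_tuple V W (u : 'Hom(W, V)) : (\dim {:V}).-tuple (S W) :=
  [tuple form_poly (coord_form i \o u)%VF | i < \dim {:V}].

Lemma tnth_pull V W (u : 'Hom(W, V)) i :
  tnth (pull_tuple u) i = form_poly (coord_form i \o u)%VF.
Proof. by rewrite /pull_tuple tnth_mktuple. Qed.

Local Notation pull u := (comp_mpoly (pull_tuple u)).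

Lemma pull_form V W (u : 'Hom(W, V)) a : pull u (form_poly a) = form_poly (a \o u)%VF.
Proof.
rewrite {1}/form_poly raddf_sum /=; apply/esym.
transitivity (@form_poly K W
    (\sum_(i < \dim {:V}) (a (vbasis {:V})`_i : K) *: (coord_form i \o u)%VF)).
  congr form_poly; apply: eq_form => w; rewrite form_compE linear_form_sum form_sumE.
  by apply: eq_bigr => i _; rewrite formZE form_compE.
rewrite raddf_sum; apply: eq_bigr => i _ /=.
by rewrite comp_mpolyZ comp_mpolyXU -[(pull_tuple u)`_i]tnth_nth tnth_pull form_polyZ.
Qed.

Lemma pull_comp V W U (u : 'Hom(W, V)) (w : 'Hom(U, W)) p :
  pull w (pull u p) = pull (u \o w)%VF p.
Proof.
rewrite comp_mpolyA; congr (_ \mPo _); apply: eq_from_tnth => i.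
by rewrite [LHS]tnth_mktuple !tnth_pull pull_form comp_lfunA.
Qed.

Lemma pull_id V p : pull (\1%VF : 'End(V)) p = p.
Proof.
rewrite -[RHS]comp_mpoly_id; congr (_ \mPo _); apply: eq_from_tnth => i.
by rewrite tnth_pull tnth_mktuple comp_lfun1r form_poly_coord.
Qed.

Lemma pull_homog V W (u : 'Hom(W, V)) d p :
  p \is d.-homog -> pull u p \is d.-homog.
Proof.
by apply: comp_mpoly_homog => i; rewrite tnth_pull form_poly_homog.
Qed.

(** Pulling back along [incl] restricts polynomials to [H]; pulling back along [proj], a retraction
    along some complement, extends them to V. *)
Definition incl V (H : {vspace V}) : 'Hom(subvs_of H, V) := linfun vsval.
Definition proj V (H : {vspace V}) : 'Hom(V, subvs_of H) := linfun (vsproj H).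

Lemma proj_incl V (H : {vspace V}) : (proj H \o incl H)%VF = \1%VF.
Proof. by apply/lfunP => w; rewrite comp_lfunE !lfunE /= vsvalK. Qed.

Lemma pull_inclK V (H : {vspace V}) p : pull (incl H) (pull (proj H) p) = p.
Proof. by rewrite pull_comp proj_incl pull_id. Qed.

Lemma form_incl_proj V (a b : 'Hom(V, K^o)) :
  exists k : K, b = ((b \o incl (lker a)) \o proj (lker a))%VF + k *: a.
Proof.
pose c := b - ((b \o incl (lker a)) \o proj (lker a))%VF.
have [k ck] : exists k : K, c = k *: a.
  apply: lker_sub_scale; apply/subvP => v va; rewrite memv_ker.
  by rewrite add_lfunE opp_lfunE !comp_lfunE !lfunE /= vsprojK // subrr.
by exists k; rewrite -ck addrC subrK.
Qed.

Lemma form_incl V (a : 'Hom(V, K^o)) : (a \o incl (lker a))%VF = 0.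
Proof.
apply: eq_form => w; rewrite form_compE form0E lfunE /=.
by apply/eqP; rewrite -form_kerE subvsP.
Qed.

(** Replacing the identity by [incl \o proj] changes each coordinate form, hence [p], by a multiple
    of [form_poly a]; and the result factors through the restriction of [p], so it is 0 when that
    restriction is. *)
Lemma pull_incl_ker V (a : 'Hom(V, K^o)) p :
  pull (incl (lker a)) p = 0 <-> exists q, p = form_poly a * q.
Proof.
split=> [p0|[q ->]]; last first.
  by rewrite rmorphM /= pull_form form_incl linear0 mul0r.
have [|q pE] := @comp_mpoly_congr K _ _ (form_poly a) (pull_tuple \1%VF)
    (pull_tuple (incl (lker a) \o proj (lker a))%VF) p.
  move=> i; rewrite !tnth_pull comp_lfun1r.
  have [k {1}->] := form_incl_proj a (coord_form i).
  exists k%:MP; rewrite linearD /= form_polyZ mulrC mul_mpolyC; congr (form_poly _ + _).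
  by rewrite comp_lfunA.
by exists q; move: pE; rewrite pull_id -pull_comp p0 comp_mpoly0 add0r.
Qed.

(** Restriction to the hyperplane takes values in a domain, and its kernel is the ideal of
    [form_poly a]. *)
Lemma form_prime V (a : 'Hom(V, K^o)) p q r : form_poly a * r = p * q ->
  (exists t, p = form_poly a * t) \/ (exists t, q = form_poly a * t).
Proof.
move=> E; have : pull (incl (lker a)) (p * q) = 0 by apply/pull_incl_ker; exists r.
rewrite rmorphM => /eqP; rewrite mulf_eq0 => /orP[]/eqP/pull_incl_ker; by [left|right].
Qed.

End LinearForms.

(** * Derivations and their restriction to a hyperplane *)

Section Derivations.
Local Open Scope ring_scope.
Variables (K : fieldType).
Implicit Types (V W U : vectType K).
Local Notation S V := {mpoly K[\dim {:V}]}.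
Local Notation pull u := (comp_mpoly (pull_tuple u)).

Definition pairing V (a : 'Hom(V, K^o)) (theta : Der V) : S V :=
  \sum_(i < \dim {:V}) (a (vbasis {:V})`_i : K) *: theta 0 i.

Lemma der_app_form V (a : 'Hom(V, K^o)) (theta : Der V) :
  der_app theta (form_poly a) = pairing a theta.
Proof.
apply: eq_bigr => i _; rewrite /form_poly raddf_sum (bigD1 i) //=.
rewrite mderivZ mderivX mnm1E eqxx scale1r -[X in (X - _)%MM]add0m addmK mpolyX0.
rewrite big1 ?addr0 => [|j ji]; first by rewrite -mul_mpolyC mulr1 mulrC mul_mpolyC.
by rewrite mderivZ mderivX mnm1E (negPf ji) scale0r scaler0.
Qed.

Lemma pairing_lin V (a : 'Hom(V, K^o)) I (s : seq I) (c : I -> S V) (B : I -> Der V) :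
  pairing a (\sum_(i <- s) c i *: B i) = \sum_(i <- s) c i * pairing a (B i).
Proof.
rewrite /pairing; under [RHS]eq_bigr => i _ do rewrite mulr_sumr.
rewrite [RHS]exchange_big; apply: eq_bigr => k _ /=.
rewrite summxE scaler_sumr; apply: eq_bigr => i _.
by rewrite mxE scalerAr.
Qed.

Lemma pairingZ V (a : 'Hom(V, K^o)) c theta :
  pairing a (c *: theta) = c * pairing a theta.
Proof.
by have := pairing_lin a [:: tt] (fun=> c) (fun=> theta); rewrite !big_seq1.
Qed.

Lemma pairingDl V (a b : 'Hom(V, K^o)) theta :
  pairing (a + b) theta = pairing a theta + pairing b theta.
Proof.
by rewrite -big_split; apply: eq_bigr => i _; rewrite formDE scalerDl.
Qed.

Lemma pairingZl V k (a : 'Hom(V, K^o)) theta :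
  pairing (k *: a) theta = k *: pairing a theta.
Proof.
by rewrite scaler_sumr; apply: eq_bigr => i _; rewrite formZE scalerA.
Qed.

Lemma pairing_coord V (i : 'I_(\dim {:V})) theta :
  pairing (coord_form i) theta = theta 0 i.
Proof.
rewrite /pairing (bigD1 i) //= coord_form_basis eqxx scale1r big1 ?addr0 // => j.
by rewrite eq_sym coord_form_basis => /negPf->; rewrite scale0r.
Qed.

Lemma pairing_sum_coord V (a : 'Hom(V, K^o)) W (u : 'Hom(W, V)) theta :
  pairing (a \o u)%VF theta =
    \sum_(i < \dim {:V})
      (a (vbasis {:V})`_i : K) *: pairing (coord_form i \o u)%VF theta.
Proof.
under [RHS]eq_bigr => i _ do rewrite scaler_sumr.
rewrite [RHS]exchange_big; apply: eq_bigr => j _ /=.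
rewrite form_compE linear_form_sum scaler_suml.
by apply: eq_bigr => i _; rewrite form_compE scalerA.
Qed.

Lemma pairing_dir_der V (a : 'Hom(V, K^o)) v :
  pairing a (dir_der v) = (a v : K)%:MP.
Proof.
rewrite linear_form_sum raddf_sum; apply: eq_bigr => i _ /=.
by rewrite mxE coord_formE mpolyCM mul_mpolyC.
Qed.

Lemma pairing_homog V (a : 'Hom(V, K^o)) d (theta : Der V) :
  (forall i, theta 0 i \is d.-homog) -> pairing a theta \is d.-homog.
Proof. by move=> thd; apply: rpred_sum => i _; apply: rpredZ. Qed.

(* The coefficients of theta are restricted to H and then projected from V to H.
   The projection loses nothing when theta is tangent to H: see res_der_eq0. *)
Definition res_der V (H : {vspace V}) (theta : Der V) : Der (subvs_of H) :=
  \row_j pull (incl H) (pairing (coord_form j \o proj H)%VF theta).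

Lemma pairing_res V (H : {vspace V}) b theta :
  pairing b (res_der H theta) = pull (incl H) (pairing (b \o proj H)%VF theta).
Proof.
rewrite pairing_sum_coord raddf_sum; apply: eq_bigr => i _ /=.
by rewrite mxE comp_mpolyZ.
Qed.

Lemma res_der_lin V (H : {vspace V}) I (s : seq I) (c : I -> S V) (B : I -> Der V) :
  res_der H (\sum_(i <- s) c i *: B i) =
    \sum_(i <- s) pull (incl H) (c i) *: res_der H (B i).
Proof.
apply/rowP => j; rewrite !mxE pairing_lin summxE raddf_sum.
by apply: eq_bigr => i _ /=; rewrite rmorphM !mxE.
Qed.

Lemma res_derZ V (H : {vspace V}) c theta :
  res_der H (c *: theta) = pull (incl H) c *: res_der H theta.
Proof.
by have := res_der_lin H [:: tt] (fun=> c) (fun=> theta); rewrite !big_seq1.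
Qed.

Lemma res_dir_der V (H : {vspace V}) (w : subvs_of H) :
  res_der H (dir_der (vsval w)) = dir_der w.
Proof.
apply/rowP => j; rewrite !mxE pairing_dir_der comp_mpolyC form_compE.
by rewrite coord_formE lfunE /= vsvalK.
Qed.

Lemma res_der_homog V (H : {vspace V}) d (theta : Der V) :
  (forall i, theta 0 i \is d.-homog) -> forall j, res_der H theta 0 j \is d.-homog.
Proof. by move=> thd j; rewrite mxE; apply/pull_homog/pairing_homog. Qed.

(** Each coordinate form is a form pulled back from the hyperplane plus a multiple of [a]. On the
    hyperplane, theta kills the first part because [res_der] is zero, and the second by tangency. *)
Lemma res_der_eq0 V (a : 'Hom(V, K^o)) theta q :
  pairing a theta = form_poly a * q -> res_der (lker a) theta = 0 ->
  exists eta, theta = form_poly a *: eta.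
Proof.
move=> atheta res0.
have /fin_all_exists[eta etaE] i : exists q, theta 0 i = form_poly a * q.
  apply/pull_incl_ker; rewrite -pairing_coord.
  have [k ->] := form_incl_proj a (coord_form i).
  rewrite pairingDl pairingZl atheta comp_mpolyD comp_mpolyZ -pairing_res res0.
  rewrite rmorphM /= pull_form form_incl linear0 mul0r scaler0 addr0.
  by rewrite /pairing big1 // => j _; rewrite mxE scaler0.
by exists (\row_i eta i); apply/rowP => i; rewrite !mxE.
Qed.

End Derivations.

(** * Restriction and the Euler multiplicity *)

Section LogarithmicDerivations.
Local Open Scope ring_scope.
Variables (K : fieldType).
Implicit Types (V W U : vectType K).
Local Notation S V := {mpoly K[\dim {:V}]}.
Local Notation pull u := (comp_mpoly (pull_tuple u)).

(** By primality each factor [form_poly b] moves into [g] or [h]; once none is left, [g] is a unit,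
    hence a constant. *)
Lemma form_pow_divisor V (b : 'Hom(V, K^o)) (k : K) N (g h : S V) :
  b != 0 -> k != 0 -> k *: form_poly b ^+ N = g * h ->
  exists (k' : K) j, g = k' *: form_poly b ^+ j.
Proof.
move=> b0 k0; elim: N g h => [|N IH] g h E.
  have /andP[/eqP gE _] : g \in GRing.unit.
    apply/unitrP; exists (k^-1 *: h); rewrite -scalerAl -scalerAr mulrC -E.
    by rewrite expr0 scalerA mulVf // scale1r.
  by exists g@_0, 0%N; rewrite {1}gE expr0 -mul_mpolyC mulr1.
have fb0 : form_poly b != 0 by rewrite form_poly_eq0.
have [] := @form_prime K V b g h (k *: form_poly b ^+ N).
- by rewrite -E exprS -scalerAr.
- move=> [t gE]; have [|k' [j tE]] := IH t h.
    by apply: (mulfI fb0); rewrite -scalerAr -exprS E gE mulrA.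
  by exists k', j.+1; rewrite gE tE exprS scalerAr.
- move=> [t hE]; apply: (IH g t).
  by apply: (mulfI fb0); rewrite -scalerAr -exprS E hE mulrCA.
Qed.

Lemma form_pow_cancel V (a b : 'Hom(V, K^o)) n f q :
  b != 0 -> ~~ (lker b <= lker a)%VS ->
  form_poly a * f = form_poly b ^+ n * q -> exists q', f = form_poly b ^+ n * q'.
Proof.
move=> b0 nba; have fb0 : form_poly b != 0 by rewrite form_poly_eq0.
elim: n f => [|n IH] f E; first by exists f; rewrite expr0 mul1r.
have [] := @form_prime K V b (form_poly a) f (form_poly b ^+ n * q).
- by rewrite mulrA -exprS E.
- move=> dvd; case/negP: nba; apply/subvP => v vb.
  have /pull_incl_ker := dvd; rewrite pull_form => /eqP.
  rewrite form_poly_eq0 => /eqP ab0.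
  have : (a \o incl (lker b))%VF (vsproj (lker b) v) = 0 :> K by rewrite ab0 form0E.
  by rewrite form_compE lfunE /= vsprojK // => av0; rewrite form_kerE av0.
- move=> [t fE]; have [|q' tE] := IH t; last by exists q'; rewrite fE tE exprS mulrA.
  by apply: (mulfI fb0); rewrite mulrCA -fE E exprS mulrA.
Qed.

Section FixedArrangement.
Variables (V : vectType K) (A : {fset {vspace V}}) (m : {vspace V} -> nat).
Variable alpha : {vspace V} -> 'Hom(V, K^o).
Implicit Types (theta : Der V).

Lemma logderP theta : logder A m alpha theta <->
  forall H, H \in A ->
    exists q, pairing (alpha H) theta = form_poly (alpha H) ^+ m H * q.
Proof. by split=> th H /th[q]; exists q; rewrite -?der_app_form // der_app_form. Qed.

(** The product supplies the required power for H in [B]; for the other H the derivative of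
    [alpha H] along [v] is already 0. *)
Lemma logder_prod (B : {fset {vspace V}}) v :
  (forall H, H \in A -> H \notin B -> alpha H v = 0 :> K) ->
  logder A m alpha ((\prod_(H <- B) form_poly (alpha H) ^+ m H) *: dir_der v).
Proof.
move=> v0; apply/logderP => H HA; rewrite pairingZ pairing_dir_der.
have [HB|HB] := boolP (H \in B); last by exists 0; rewrite v0 // mpolyC0 !mulr0.
by rewrite (big_fsetD1 H) //= -mulrA; eexists.
Qed.

Hypotheses (mA : is_multiarrangement A m) (fA : defining_forms A alpha).

Lemma form_neq0 H : H \in A -> alpha H != 0.
Proof.
move=> HA; have [dimH _] := mA HA; apply: contra_eq_neq dimH => a0.
have -> : H = fullv.
  by apply/vspaceP => v; rewrite -(fA HA) form_kerE a0 form0E eqxx memvf.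
by rewrite -[X in _ != X]addn0 -addn1 eqn_add2l.
Qed.

Lemma hyperplane_eq H1 H2 : H1 \in A -> H2 \in A -> (H1 <= H2)%VS -> H1 = H2.
Proof.
move=> HA1 HA2 sub12; apply/eqP; rewrite eqEdim sub12 /= -ltnS.
by rewrite (mA HA1).1 (mA HA2).1.
Qed.

Lemma form_incl_neq0 H H0 : H0 \in A -> H \in A -> H != H0 ->
  (alpha H \o incl H0)%VF != 0.
Proof.
move=> HA0 HA; apply: contraNneq => a0; apply/eqP/esym/hyperplane_eq => //.
apply/subvP => v vH0; rewrite -(fA HA) form_kerE -[v](vsprojK vH0).
have := form0E (vsproj H0 v); rewrite -a0 form_compE lfunE /= => ->.
by rewrite eqxx.
Qed.

End FixedArrangement.

Lemma localizationE V (A : {fset {vspace V}}) X H :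
  (H \in localization A X) = (H \in A) && (X <= H)%VS.
Proof. by rewrite !inE. Qed.

Section Euler.
Variables (V : vectType K) (A : {fset {vspace V}}) (m : {vspace V} -> nat).
Variables (alpha : {vspace V} -> 'Hom(V, K^o)) (H0 : {vspace V}).
Hypotheses (mA : is_multiarrangement A m) (fA : defining_forms A alpha).
Hypotheses (H0A : H0 \in A) (dimV : (2 <= \dim {:V})%N).

(* The values theta(beta)|_H0 for theta in D(A_X, m_X) are multiples of
   g = theta_X(beta)|_H0. The derivation Q v, with Q the product of the
   alpha_H^m(H) over H != H0 in A_X and v in H0, shows that a nonzero multiple of a
   power of beta is such a value; hence g is itself one, of exponent
   deg theta_X = d. *)
Lemma euler_mult_divides (X : {vspace subvs_of H0}) d (beta : 'Hom(subvs_of H0, K^o))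
    (theta : Der V) :
  lker beta = X -> is_euler_mult A m alpha X d -> logder A m alpha theta ->
  exists q, pairing beta (res_der H0 theta) = form_poly beta ^+ d * q.
Proof.
move=> kbeta; rewrite /is_euler_mult.
set XV := lfun_img _ _; set AX := localization _ _.
move=> [e [thX [psX [p [[ebas eX] [spanB _] [[_ thXd] _] _ [eta psE]]]]]] thA.
(* [X] is not assumed to be a proper subspace, so [beta] may be zero. *)
have [beta0|beta_n0] := eqVneq beta 0.
  by exists 0; rewrite mulr0 beta0 /pairing big1 // => i _; rewrite form0E scale0r.
pose L t := pairing beta (res_der H0 t).
pose B (i : 'I_(\dim {:V})) :=
  if val i == 0%N then thX else if val i == 1%N then psX else dir_der e`_i.
pose i0 := Ordinal (ltnW dimV).
have a0 : (alpha H0 \o incl H0)%VF = 0.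
  apply: eq_form => w; rewrite form_compE form0E lfunE /=.
  by apply/eqP; rewrite -form_kerE (fA H0A) subvsP.
(* psi_X is a multiple of alpha_0, which vanishes on H0, and the remaining basis elements are
   derivatives along vectors of X, where [beta] vanishes. *)
have LB i : i != i0 -> L (B i) = 0.
  move=> ii0; rewrite /L /B.
  have -> /= : (val i == 0%N) = false.
    by apply: contraNF ii0 => /eqP i0E; apply/eqP/val_inj.
  case: ifP => [_|i1].
    rewrite psE res_derZ pairingZ pull_form a0 linear0 mul0r //.
  have /memv_imgP[w wX ->] : e`_i \in XV.
    apply/eX => j j2; rewrite coord_free ?(basis_free ebas) //.
    case: eqP => // ij; move: ii0 i1 j2; rewrite -ij -val_eqE /=.
    by case: (nat_of_ord _) => [|[|]].
  rewrite lfunE /= res_dir_der pairing_dir_der.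
  by move: wX; rewrite -kbeta form_kerE => /eqP->; rewrite mpolyC0.
have Lgen t : logder AX m alpha t -> exists c, L t = c * L thX.
  move=> /spanB[c ->]; exists (pull (incl H0) (c i0)).
  rewrite /L res_der_lin pairing_lin (bigD1 i0) //= big1 ?addr0 // => i ii0.
  by rewrite -/(L _) (LB _ ii0) mulr0.
have AXA H : H \in AX -> H \in A by rewrite localizationE => /andP[].
have mAX : is_multiarrangement AX m by move=> H /AXA /mA.
have fAX : defining_forms AX alpha by move=> H /AXA /fA.
have thAX : logder AX m alpha theta by move=> H /AXA; apply: thA.
have [w bw] : exists w, beta w != 0 :> K.
  have : ~~ (fullv <= lker beta)%VS.
    apply: contraNN beta_n0 => /subvP full; apply/eqP/eq_form => w.
    by rewrite form0E; apply/eqP; rewrite -form_kerE full ?memvf.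
  by case/subvPn => w _; rewrite form_kerE; exists w.
pose Q := \prod_(H <- (AX `\ H0)%fset) form_poly (alpha H) ^+ m H.
have [c LQ] : exists c, L (Q *: dir_der (vsval w)) = c * L thX.
  apply/Lgen/logder_prod => H HA; rewrite in_fsetD1 HA andbT negbK => /eqP ->.
  by apply/eqP; rewrite -form_kerE (fA H0A) subvsP.
(* For H != H0 containing X, the restriction of alpha_H to H0 is nonzero and vanishes on X, so it is
   a nonzero multiple of [beta]. *)
have [k [N [k0 QE]]] : exists k N,
    k != 0 /\ pull (incl H0) Q = k *: form_poly beta ^+ N.
  rewrite /Q big_seq; elim/big_rec: _ => [|H x HAX [k [N [k0 xE]]]].
    by exists 1, 0%N; rewrite oner_neq0 comp_mpoly1 expr0 scale1r.
  move: HAX; rewrite in_fsetD1 => /andP[HH0 HAX].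
  have [h hE] : exists h : K, (alpha H \o incl H0)%VF = h *: beta.
    apply: lker_sub_scale; apply/subvP => x'; rewrite kbeta => x'X.
    rewrite form_kerE form_compE -form_kerE (fAX _ HAX).
    move: HAX; rewrite localizationE => /andP[_ /subvP]; apply.
    exact: memv_img.
  have h0 : h != 0.
    apply: contraNneq (form_incl_neq0 mA fA H0A (AXA _ HAX) HH0) => h0.
    by rewrite hE h0 scale0r.
  exists (h ^+ m H * k), (m H + N)%N; split; first by rewrite mulf_neq0 ?expf_neq0.
  rewrite rmorphM rmorphXn /= xE pull_form hE form_polyZ exprZn exprD.
  by rewrite -scalerAl -scalerAr scalerA.
have LQE : L (Q *: dir_der (vsval w)) = (k * (beta w : K)) *: form_poly beta ^+ N.
  rewrite /L res_derZ pairingZ res_dir_der pairing_dir_der QE mulrC mul_mpolyC.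
  by rewrite scalerA mulrC.
have kb0 : k * (beta w : K) != 0 by rewrite mulf_neq0.
have [k' [j gE]] : exists (k' : K) j, L thX = k' *: form_poly beta ^+ j.
  by move: LQE; rewrite LQ mulrC => /esym /(form_pow_divisor beta_n0 kb0).
have fb0 : form_poly beta != 0 by rewrite form_poly_eq0.
have g0 : L thX != 0.
  apply: contraNneq kb0 => g0; move: LQE; rewrite LQ g0 mulr0 => /esym/eqP.
  by rewrite scaler_eq0 expf_eq0 (negPf fb0) andbF orbF.
have jd : j = d.
  apply: (dhomog_uniq g0); last by apply/pairing_homog/res_der_homog.
  rewrite gE; apply: rpredZ.
  by have := dhomogMn j (form_poly_homog beta); rewrite mul1n.
have [c' thE] := Lgen _ thAX; rewrite -/(L theta) thE; exists (k' *: c').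
by rewrite gE jd -scalerAr mulrC scalerAr.
Qed.

End Euler.
End LogarithmicDerivations.

(** * Deletion *)

Section Bases.
Local Open Scope ring_scope.
Variables (K : fieldType).
Implicit Types (V : vectType K).
Local Notation S V := {mpoly K[\dim {:V}]}.
Local Notation pull u := (comp_mpoly (pull_tuple u)).

Lemma row_comb_mulmx V r (c : 'I_r -> S V) (B : 'I_r -> Der V) :
  \sum_i c i *: B i = (\row_i c i) *m (\matrix_i B i).
Proof.
by rewrite mulmx_sum_row; apply: eq_bigr => i _; rewrite mxE rowK.
Qed.

Lemma dir_der_basis V (k : 'I_(\dim {:V})) : dir_der (vbasis {:V})`_k = delta_mx 0 k.
Proof.
by apply/rowP => i; rewrite !mxE -coord_formE coord_form_basis mpolyC_nat.
Qed.

Lemma basis_size_le V M r (B : 'I_r -> Der V) : is_basis M B -> (r <= \dim {:V})%N.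
Proof.
move=> [_ freeB]; rewrite leqNgt; apply/negP => /domain_rows_dependent.
case/(_ _ (\matrix_i B i)) => c /eqP c0 cB; apply: c0; apply/rowP => i.
rewrite mxE; apply: (freeB (fun i => c 0 i)); rewrite row_comb_mulmx -cB.
by congr (_ *m _); apply/rowP => j; rewrite mxE.
Qed.

Lemma scalar_factor V r (B : 'I_r -> Der V) (Q : S V) :
  (forall v, exists c : 'I_r -> S V, Q *: dir_der v = \sum_i c i *: B i) ->
  exists W, W *m (\matrix_i B i) = Q%:M.
Proof.
move=> spanQ.
have /fin_all_exists[c cE] := fun k : 'I_(\dim {:V}) => spanQ (vbasis {:V})`_k.
exists (\matrix_k \row_i c k i); apply/row_matrixP => k.
rewrite row_mul rowK -row_comb_mulmx -cE dir_der_basis.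
by rewrite -scalemx1 linearZ /= row1.
Qed.

Lemma basis_size V M r (B : 'I_r -> Der V) (Q : S V) :
  Q != 0 -> (forall v, M (Q *: dir_der v)) -> is_basis M B -> r = \dim {:V}.
Proof.
move=> Q0 MQ basB; apply/eqP; rewrite eqn_leq (basis_size_le basB) /=.
have [W WB] := scalar_factor (fun v => (basB.1 _).1 (MQ v)).
exact: domain_scalar_factor Q0 WB.
Qed.

Lemma seq_mset_codomE r (d : 'I_r -> nat) t :
  seq_mset (codom d) t = #|[set i | d i == t]|.
Proof.
rewrite mset_seqE /codom /image_mem count_map -sum1_card -sum1_count.
by rewrite big_enum_cond; apply: eq_bigl => i; rewrite inE.
Qed.

End Bases.

Section Deletion.
Local Open Scope ring_scope.
Variables (K : fieldType) (V : vectType K) (A : {fset {vspace V}}).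
Variables (m : {vspace V} -> nat) (alpha : {vspace V} -> 'Hom(V, K^o)).
Variable H0 : {vspace V}.
Hypotheses (mA : is_multiarrangement A m) (fA : defining_forms A alpha).
Hypothesis H0A : H0 \in A.
Local Notation S V := {mpoly K[\dim {:V}]}.
Local Notation pull u := (comp_mpoly (pull_tuple u)).
Local Notation a0 := (form_poly (alpha H0)).
Local Notation D := (logder A m alpha).
Local Notation D' := (logder (deletion A m H0) (deletion_mult m H0) alpha).

Lemma alpha_neq0 : a0 != 0.
Proof. by rewrite form_poly_eq0 (form_neq0 mA fA H0A). Qed.

(** At H != H0 the factor alpha_0 is prime to alpha_H and cancels; at H0 it lowers the exponent by
    one, and for [m H0 = 1] no condition remains. This treats both kinds of deletion at once. *)
Lemma deletionP theta : D' theta <-> D (a0 *: theta).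
Proof.
have m0 := (mA H0A).2.
rewrite !logderP; split=> th H HA; last first.
  have HA' : H \in A.
    by move: HA; rewrite /deletion; case: ifP; rewrite // in_fsetD1 => _ /andP[].
  have [q] := th H HA'; rewrite pairingZ.
  have [HH0|HH0] := eqVneq H H0; last first.
    move=> /(form_pow_cancel (form_neq0 mA fA HA')) [|q' ->].
      apply: contraNN HH0; rewrite (fA HA') (fA H0A) => sub.
      by apply/eqP; apply: (hyperplane_eq mA HA' H0A sub).
    by exists q'; rewrite /deletion_mult (negPf HH0).
  move=> E; rewrite HH0 in HA E *; exists q; rewrite /deletion_mult eqxx /=.
  apply: (mulfI alpha_neq0); rewrite E mulrA -exprS; congr (_ ^+ _ * _).
  case: ifP => [m2|]; first by rewrite prednK.
  move: HA; rewrite /deletion; case: ifP => [_|]; first by rewrite in_fsetD1 eqxx.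
  by move: m0; case: (m H0) => [|[|]].
rewrite pairingZ.
have [HH0|HH0] := eqVneq H H0; last first.
  have [|q ->] := th H; first by rewrite /deletion; case: ifP; rewrite // in_fsetD1 HH0.
  by exists (a0 * q); rewrite /deletion_mult (negPf HH0) mulrCA.
rewrite HH0; have [m1|m1] := eqVneq (m H0) 1%N.
  by exists (pairing (alpha H0) theta); rewrite m1.
have [|q ->] := th H0; first by rewrite /deletion (negPf m1).
have m2 : (1 < m H0)%N by rewrite ltn_neqAle eq_sym m1.
by exists q; rewrite /deletion_mult eqxx m2 mulrA -exprS prednK.
Qed.

Lemma prod_forms_res_neq0 :
  pull (incl H0) (\prod_(H <- (A `\ H0)%fset) form_poly (alpha H) ^+ m H) != 0.
Proof.
rewrite rmorph_prod /= big_seq; elim/big_rec: _ => [|H x]; first exact: oner_neq0.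
rewrite in_fsetD1 => /andP[HH0 HA] x0; rewrite mulf_neq0 // rmorphXn /= expf_neq0 //.
by rewrite pull_form form_poly_eq0 (form_incl_neq0 mA fA).
Qed.

Lemma logder_basis_size r (B : 'I_r -> Der V) : is_basis D B -> r = \dim {:V}.
Proof.
apply: (@basis_size _ _ _ _ _ (\prod_(H <- A) form_poly (alpha H) ^+ m H)).
  rewrite big_seq; elim/big_rec: _ => [|H x HA x0]; first exact: oner_neq0.
  by rewrite mulf_neq0 // expf_neq0 // form_poly_eq0 (form_neq0 mA fA HA).
by move=> v; apply: logder_prod => H ->.
Qed.

(* The images of the basis generate a submodule of Der(H0) of full rank, since it
   contains Q|_H0 Der(H0); as B i0 is redundant, \dim V - 1 = \dim H0 of the images
   suffice, and must then be independent. *)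
Lemma res_free r (B : 'I_r -> Der V) i0 (c : 'I_r -> S (subvs_of H0)) :
  is_basis D B -> c i0 = 1 -> \sum_i c i *: res_der H0 (B i) = 0 ->
  forall b : 'I_r -> S (subvs_of H0), b i0 = 0 ->
    \sum_i b i *: res_der H0 (B i) = 0 -> forall i, b i = 0.
Proof.
move=> basB c1 c0 b b0 bB; have rV := logder_basis_size basB.
case: r => [|r] in B i0 c basB c1 c0 b b0 bB rV *; first by case: i0 c1 b0.
have cB : res_der H0 (B i0) = - \sum_k c (lift i0 k) *: res_der H0 (B (lift i0 k)).
  apply/eqP; rewrite -addr_eq0; apply/eqP.
  by rewrite -[RHS]c0 [RHS](bigD1_ord i0) //= c1 scale1r.
pose Q := \prod_(H <- (A `\ H0)%fset) form_poly (alpha H) ^+ m H.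
have [W WT] : exists W,
    W *m (\matrix_k res_der H0 (B (lift i0 k))) = (pull (incl H0) Q)%:M.
  apply: scalar_factor => w.
  have /basB.1[t tE] : D (Q *: dir_der (vsval w)).
    apply: logder_prod => H HA; rewrite in_fsetD1 HA andbT negbK => /eqP ->.
    by apply/eqP; rewrite -form_kerE (fA H0A) subvsP.
  exists (fun k =>
    pull (incl H0) (t (lift i0 k)) - pull (incl H0) (t i0) * c (lift i0 k)).
  rewrite -res_dir_der -res_derZ tE res_der_lin (bigD1_ord i0) //= cB.
  rewrite scalerN scaler_sumr -sumrN -big_split; apply: eq_bigr => k _ /=.
  by rewrite scalerBl scalerA addrC.
have b_lift k : b (lift i0 k) = 0.
  have := domain_rows_free prod_forms_res_neq0 WT.
  have -> : (r <= \dim {:subvs_of H0})%N.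
    by rewrite dimvf -ltnS rV -(mA H0A).1.
  move=> /(_ isT (\row_k b (lift i0 k))).
  rewrite -row_comb_mulmx => free.
  have /rowP/(_ k) : \row_k b (lift i0 k) = 0.
    by apply: free; rewrite -[RHS]bB [RHS](bigD1_ord i0) //= b0 scale0r add0r.
  by rewrite !mxE.
by move=> i; case: (unliftP i0 i) => [k|] ->.
Qed.

Lemma deletion_free r (B : 'I_r -> Der V) i0 (c : 'I_r -> S (subvs_of H0)) :
  is_basis D B -> c i0 = 1 -> \sum_i c i *: res_der H0 (B i) = 0 -> is_free D'.
Proof.
move=> basB c1 c0; have kH0 := fA H0A.
have a0H0 : (alpha H0 \o incl H0)%VF = 0 by have := form_incl (alpha H0); rewrite kH0.
(* Lifting the relation to V gives an element [th] of D(A, m) that restricts to 0 and has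
   coefficient 1 at [B i0]. *)
pose c' i : S V := if i == i0 then 1 else pull (proj H0) (c i).
have c'K i : pull (incl H0) (c' i) = c i.
  by rewrite /c'; case: eqP => [->|_]; rewrite ?comp_mpoly1 ?c1 // pull_inclK.
pose th := \sum_i c' i *: B i.
have thD : D th by apply/basB.1; exists c'.
have [eta thE] : exists eta, th = a0 *: eta.
  have [q pE] := (logderP A m alpha th).1 thD _ H0A.
  apply: (@res_der_eq0 _ _ _ _ (a0 ^+ (m H0).-1 * q)).
    by rewrite pE mulrA -exprS prednK // (mA H0A).2.
  rewrite kH0 res_der_lin -[RHS]c0; apply: eq_bigr => i _.
  by rewrite c'K.
pose B' i := if i == i0 then eta else B i.
(* Multiplying by alpha_0 moves combinations of [B'] into D(A, m), where coefficients in the basis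
   [B] can be compared. *)
have a0B' (b : 'I_r -> S V) : a0 *: \sum_i b i *: B' i =
    \sum_i ((if i == i0 then 0 else a0 * b i) + b i0 * c' i) *: B i.
  under [RHS]eq_bigr => i _ do rewrite scalerDl.
  rewrite big_split /=.
  under [X in _ = _ + X]eq_bigr => i _ do rewrite -scalerA.
  rewrite -scaler_sumr -/th thE scalerA scaler_sumr !(bigD1 i0 (P := xpredT)) //=.
  rewrite /B' eqxx scale0r add0r scalerA [b i0 * _]mulrC addrC; congr (_ + _).
  by apply: eq_bigr => i ii0; rewrite (negPf ii0) scalerA.
exists r, B'; split=> [zeta|b bB i].
  rewrite deletionP; split=> [/basB.1[b bE]|[b ->]]; last first.
    by rewrite a0B'; apply/basB.1; eexists.
  (* Subtracting a multiple of the relation [c] cancels the coefficient at [i0], so [res_free]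
     applies: each [b i] is congruent to [b i0 * c' i] modulo alpha_0. *)
  have bres : \sum_i (pull (incl H0) (b i) - pull (incl H0) (b i0) * c i) *:
      res_der H0 (B i) = 0.
    under eq_bigr => i _ do rewrite scalerBl -scalerA.
    rewrite sumrB -scaler_sumr c0 scaler0 subr0 -res_der_lin -bE res_derZ.
    by rewrite pull_form a0H0 linear0 scale0r.
  have /fin_all_exists[t tE] i : exists t, b i - b i0 * c' i = a0 * t.
    apply/pull_incl_ker; rewrite kH0 rmorphB rmorphM /= c'K.
    by apply: (res_free basB c1 c0 _ bres); rewrite c1 mulr1 subrr.
  exists (fun i => if i == i0 then b i0 else t i).
  have a0I : injective (fun eta : Der V => a0 *: eta).
    move=> x y /rowP xy; apply/rowP => i; apply: (mulfI alpha_neq0).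
    by have := xy i; rewrite !mxE.
  apply: a0I => /=; rewrite a0B' bE; apply: eq_bigr => i _; congr (_ *: _).
  rewrite eqxx; have [->|ii0] := eqVneq i i0; last by rewrite -tE subrK.
  by rewrite /c' eqxx mulr1 add0r.
have bc0 : forall i, (if i == i0 then 0 else a0 * b i) + b i0 * c' i = 0.
  by apply: basB.2; rewrite -a0B' bB scaler0.
have bi0 : b i0 = 0 by have := bc0 i0; rewrite eqxx /c' eqxx mulr1 add0r.
have := bc0 i; rewrite bi0 mul0r addr0; case: eqP => [->//|_ /eqP].
by rewrite mulf_eq0 (negPf alpha_neq0) => /eqP.
Qed.

End Deletion.

Theorem theorem0p5 (K : fieldType) (V : vectType K)
    (A : {fset {vspace V}}) (m : {vspace V} -> nat)
    (alpha : {vspace V} -> 'Hom(V, K^o))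
    (H0 : {vspace V})
    (mstar : {vspace subvs_of H0} -> nat)
    (beta : {vspace subvs_of H0} -> 'Hom(subvs_of H0, K^o))
    (E Er : {mset nat}%mset) :
  (2 <= \dim (@fullv K V))%N ->
  is_multiarrangement A m ->
  defining_forms A alpha ->
  H0 \in A ->
  defining_forms (restriction A H0) beta ->
  (forall X, X \in restriction A H0 -> is_euler_mult A m alpha X (mstar X)) ->
  is_free (logder A m alpha) ->
  is_free (logder (restriction A H0) mstar beta) ->
  is_exp (logder A m alpha) E ->
  is_exp (logder (restriction A H0) mstar beta) Er ->
  (Er `<=` E)%mset ->
  is_free (logder (deletion A m H0) (deletion_mult m H0) alpha).
Proof.
move=> dimV mA fA H0A fbeta euler _ _ [r [B [d [basB homB ->]]]].
move=> [s [C [e [basC homC ->]]]] /msubsetP leE.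
(* The inclusion of exponents is strict by rank: [s] is at most the dimension of H0, and [r] is the
   dimension of V. *)
have ltsr : (s < r)%N.
  rewrite (logder_basis_size mA fA basB) -(mA H0 H0A).1 ltnS.
  by have := basis_size_le basC; rewrite dimvf.
have [||||i0 [c [c1 c0]]] := @graded_redundancy K _ _ r s
    (fun i => res_der H0 (B i)) C d e _ _ _ _ ltsr.
- by move=> i; apply: res_der_homog; case: (homB i).
- by move=> j; case: (homC j).
- move=> i; apply/basC.1/logderP => X XA.
  apply: (euler_mult_divides mA fA H0A dimV (fbeta X XA) (euler X XA)).
  apply/basB.1; exists (fun j => (j == i)%:R)%R.
  rewrite (bigD1 i) //= eqxx scale1r big1 ?addr0 // => j /negPf->.
  by rewrite scale0r.
- by move=> t; have := leE t; rewrite !seq_mset_codomE.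
exact: deletion_free basB c1 c0.
Qed.
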